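(* For every $\varepsilon>0$ there is $n_0$ such that every triangle-free graph on $n\ge n_0$ vertices has fractional chromatic number at most $(2+\varepsilon)\sqrt{n/\log n}$.
   Context: The fractional chromatic number of a graph $G$ is the smallest $k$ such that there is a probability distribution over stable sets of $G$ under which every vertex lies in the random stable set with probability at least $1/k$. $\log$ is the natural logarithm. *)

(* Defs.v *)
From mathcomp Require Import all_boot all_order all_algebra.
From mathcomp Require Import boolp classical_sets functions reals.
From mathcomp Require Import topology normedtype derive exp.

Set Implicit Arguments.
Unset Strict Implicit.
Unset Printing Implicit Defensive.

Import Order.TTheory GRing.Theory Num.Theory.
Import numFieldTopology.Exports numFieldNormedType.Exports.

Local Open Scope classical_set_scope.
Local Open Scope ring_scope.

Definition simple_graph (T : finType) (e : rel T) : Prop :=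
  symmetric e /\ irreflexive e.

Definition triangle_free (T : finType) (e : rel T) : Prop :=
  forall x y z : T, ~~ [&& e x y, e y z & e x z].

Definition stable_set (T : finType) (e : rel T) (S : {set T}) : bool :=
  [forall x in S, forall y in S, ~~ e x y].

Definition stable_distribution (R : realType) (T : finType) (e : rel T)
    (p : {set T} -> R) : Prop :=
  [/\ forall S, 0 <= p S,
      forall S, ~~ stable_set e S -> p S = 0
    & \sum_(S : {set T}) p S = 1].

Definition fractionally_colorable (R : realType) (T : finType) (e : rel T)
    (k : R) : Prop :=
  0 < k /\
  exists2 p : {set T} -> R, stable_distribution e p &
    forall v : T, k^-1 <= \sum_(S : {set T} | v \in S) p S.

(* For a nonempty graph this infimum is a minimum, as proved below. *)
Definition fractional_chromatic_number (R : realType) (T : finType)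
    (e : rel T) : R :=
  inf [set k : R | fractionally_colorable e k].

Lemma fractional_chromatic_number_min (R : realType) (T : finType)
    (e : rel T) :
  irreflexive e -> (0 < #|T|)%N ->
  fractionally_colorable e (fractional_chromatic_number R e) /\
  forall k : R, fractionally_colorable e k ->
    fractional_chromatic_number R e <= k.
Proof.
move=> irr_e /card_gt0P[v0 _].
suff [k0 Fk0 k0min] : exists2 k0 : R, fractionally_colorable e k0 &
    forall k : R, fractionally_colorable e k -> k0 <= k.
  have -> : fractional_chromatic_number R e = k0; last by [].
  apply/eqP; rewrite eq_le; apply/andP; split.
    by apply: ge_inf => //; exists k0 => k /= /k0min.
  by apply: lb_le_inf; [exists k0 | move=> k /= /k0min].
set m := #|{: {set T}}|.
pose P (v : 'rV[R]_m) (S : {set T}) := v ord0 (enum_rank S).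
pose C : set ('rV[R]_m * R) :=
  [set x | stable_distribution e (P x.1) /\
     forall v : T, x.2 <= \sum_(S : {set T} | v \in S) P x.1 S].
pose B : set ('rV[R]_m * R) :=
  [set v : 'rV[R]_m | forall i, `[0, 1]%classic (v ord0 i)] `*`
  `[0, 1]%classic.
pose A := B `&` C.
have cP S : continuous (fun x : 'rV[R]_m * R => P x.1 S).
  move=> x; apply: (@continuous_comp _ _ _ fst (fun v : 'rV[R]_m => P v S)).
    exact: cvg_fst.
  exact: coord_continuous.
have cS (Q : pred {set T}) :
    continuous (fun x : 'rV[R]_m * R => \sum_(S | Q S) P x.1 S).
  by apply: continuous_big => [|S _]; [exact: add_continuous|exact: cP].
have clC : closed C.
  have -> : C =
    (\bigcap_(S in [set: {set T}]) [set x | 0 <= P x.1 S]) `&`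
    (\bigcap_(S in [set S | ~~ stable_set e S]) [set x | P x.1 S = 0]) `&`
    [set x | \sum_(S : {set T}) P x.1 S = 1] `&`
    (\bigcap_(v in [set: T])
       [set x | 0 <= \sum_(S : {set T} | v \in S) P x.1 S - x.2]).
    apply/seteqP; split => x /=.
      move=> [[h1 h2 h3] h4]; split=> [|v _ /=]; last by rewrite subr_ge0.
      by split=> //; split=> [S _|S /= hS]; [exact: h1|exact: h2].
    move=> [[[h1 h2] h3] h4]; split=> [|v].
      by split=> // S; exact: (h1 S).
    by rewrite -subr_ge0; exact: (h4 v).
  apply: closedI; first apply: closedI; first apply: closedI.
  - apply: closed_bigI => S _.
    by apply: (@preimage_closed _ _ (fun x : 'rV[R]_m * R => P x.1 S)
      [set y | 0 <= y]) => [x _|]; [exact: cP|exact: closed_ge].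
  - apply: closed_bigI => S _.
    by apply: (@preimage_closed _ _ (fun x : 'rV[R]_m * R => P x.1 S)
      [set y | y = 0]) => [x _|]; [exact: cP|exact: closed_eq].
  - by apply: (@preimage_closed _ _
      (fun x : 'rV[R]_m * R => \sum_(S : {set T}) P x.1 S)
      [set y | y = 1]) => [x _|]; [exact: cS|exact: closed_eq].
  - apply: closed_bigI => v _.
    apply: (@preimage_closed _ _ (fun x : 'rV[R]_m * R =>
      \sum_(S : {set T} | v \in S) P x.1 S - x.2) [set y | 0 <= y]) => [x _|].
      by apply: cvgB; [exact: cS|exact: cvg_snd].
    exact: closed_ge.
have cA : compact A.
  apply: compact_closedI => //.
  apply: compact_setX; last exact: segment_compact.
  apply: (@rV_compact R m (fun=> `[0, 1]%classic)) => i.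
  exact: segment_compact.
have inA (p : {set T} -> R) (t : R) : 0 <= t -> stable_distribution e p ->
    (forall v : T, t <= \sum_(S : {set T} | v \in S) p S) ->
    A (\row_i p (enum_val i), t).
  move=> t0 dp pt.
  have PE : P (\row_i p (enum_val i)) = p.
    by apply/funext => S; rewrite /P mxE enum_rankK.
  have [p0 _ p1] := dp.
  split; last by rewrite /C /= PE.
  have t1 : t <= 1.
    rewrite (le_trans (pt v0))// -p1 [leRHS](bigID [pred S : {set T} | v0 \in S])/=.
    by rewrite lerDl sumr_ge0.
  split=> /=; last by rewrite in_itv /= t0 t1.
  move=> i; rewrite mxE in_itv /= p0 /= -p1 (bigD1 (enum_val i)) //=.
  by rewrite lerDl sumr_ge0.
pose n := #|T|%:R : R.
have n0 : 0 < n by rewrite ltr0n; apply/card_gt0P; exists v0.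
pose p (S : {set T}) := n^-1 * \sum_(v : T) (S == [set v]%SET)%:R.
have dp : stable_distribution e p.
  split=> [S|S nS|].
  - by rewrite mulr_ge0 ?invr_ge0 ?(ltW n0) ?sumr_ge0.
  - rewrite /p big1 ?mulr0 // => v _; case: eqP => // SE.
    move: nS; rewrite SE => /negP[]; apply/forall_inP => x /set1P ->.
    by apply/forall_inP => y /set1P ->; rewrite irr_e.
  - rewrite -mulr_sumr exchange_big /= (eq_bigr (fun=> 1)) => [|v _].
      by rewrite sumr_const mulVf ?gt_eqF.
    by rewrite (bigD1 [set v]%SET) //= eqxx big1 ?addr0 // => S /negPf ->.
have pn (v : T) : n^-1 <= \sum_(S : {set T} | v \in S) p S.
  have [p0 _ _] := dp.
  rewrite (bigD1 [set v]%SET) ?set11 //= -[leLHS]addr0 lerD ?sumr_ge0 //.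
  rewrite /p ler_peMr ?invr_ge0 ?(ltW n0) // (bigD1 v) //= eqxx.
  by rewrite lerDl sumr_ge0.
have A0 : A !=set0.
  by exists (\row_i p (enum_val i), n^-1); apply: inA; rewrite ?invr_ge0 ?ltW.
have csnd : {within A, continuous (@snd 'rV[R]_m R)}.
  by apply: continuous_subspaceT => x; exact: cvg_snd.
have [x /set_mem [_ [dx xt]] xmax] := compact_EVT_max A0 cA csnd.
have maxP q t : 0 <= t -> stable_distribution e q ->
    (forall v : T, t <= \sum_(S : {set T} | v \in S) q S) -> t <= x.2.
  by move=> t0 dq qt; apply: (xmax (\row_i q (enum_val i), t)); apply/mem_set/inA.
have x0 : 0 < x.2.
  by apply: lt_le_trans (maxP p n^-1 _ dp pn); rewrite ?invr_gt0 // invr_ge0 ltW.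
exists x.2^-1.
  by split; rewrite ?invr_gt0 //; exists (P x.1) => // v; rewrite invrK.
move=> k [k0 [q dq qk]]; rewrite invf_ple ?posrE //.
by apply: (maxP q) => //; rewrite invr_ge0 ltW.
Qed.

(* Main.v *)
Require Import Defs.
From mathcomp Require Import all_boot all_order all_algebra.
From mathcomp Require Import reals sequences exp.
From mathcomp Require Import ring lra.

(** In the hard-core model at fugacity [lam] on a triangle-free graph, once the
    part of the random stable set outside [N(v)] is fixed, its trace on [N(v)]
    is a random subset of the [X] neighbours left uncovered, each kept with
    probability [lam / (1 + lam)]. Hence P(v in S) is
    [lam / (1 + lam)] times the mean of [(1 + lam)^-X], while the mean of
    #|S :&: N(v)| is [lam / (1 + lam)] times the mean of [X], and the tangent
    line of the exponential yields a P(v in S) + b E #|S :&: N(v)| >= 1 with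
    b = 1 / E0 and a = exp((1 + lam) E0) / (lam E0), for every E0 > 0.
    Using such distributions greedily on the vertices not yet covered gives a
    fractional colouring of cost a + b D under maximum degree D. Balancing this
    against removing the neighbourhood of a vertex of large degree as one colour
    class gives cost a + sqrt (2 b n); finally E0 is taken slightly below
    (ln n) / 2, which keeps a negligible. *)

Import Order.TTheory GRing.Theory Num.Theory.
Local Open Scope ring_scope.

(** * Hard-core sums over stable sets *)

Lemma stable_setP {T : finType} {e : rel T} {S : {set T}} :
  reflect {in S &, forall x y, ~~ e x y} (stable_set e S).
Proof.
apply: (iffP forall_inP) => [h x y xS yS|h x xS].
  by have /forall_inP/(_ y yS) := h x xS.
by apply/forall_inP => y yS; exact: h.
Qed.

Lemma stable_setS {T : finType} {e : rel T} {S S' : {set T}} :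
  S' \subset S -> stable_set e S -> stable_set e S'.
Proof.
move=> /subsetP sub /stable_setP st; apply/stable_setP => x y xS yS.
by apply: st; exact: sub.
Qed.

Definition nbhd {T : finType} (e : rel T) (v : T) : {set T} := [set u | e v u].

Definition stable_in {T : finType} (e : rel T) (A S : {set T}) : bool :=
  stable_set e S && (S \subset A).

(** Its size plays the role of X. Without triangles, no member of [S] inside N(v) is adjacent to a
    neighbour of [v], so the set depends only on [S] minus N(v). *)
Definition free_nbrs {T : finType} (e : rel T) (A : {set T}) (v : T)
    (S : {set T}) : {set T} :=
  [set u in A | e v u && [disjoint nbhd e u & S]].

Lemma sum_subset_expr (R : comNzRingType) (T : finType) (x : R) (X : {set T}) :
  \sum_(S : {set T} | S \subset X) x ^+ #|S| = (1 + x) ^+ #|X|.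
Proof.
(* An index outside [X] contributes the factor [0 + 1], so expanding the product leaves only subsets
   of [X]. *)
transitivity (\prod_(i : T) ((if i \in X then x else 0) + 1)); last first.
  rewrite (bigID [in X]) /= [X in _ * X]big1 ?mulr1; last first.
    by move=> i /negPf ->; rewrite add0r.
  rewrite (eq_bigr (fun=> 1 + x)) ?prodr_const // => i ->.
  by rewrite addrC.
rewrite bigA_distr big_mkcond /=; apply: eq_bigr => S _.
case: ifPn => [/subsetP sub|/subsetPn[i iS iX]]; last first.
  by rewrite (bigD1 i) //= iS (negPf iX) mul0r.
rewrite (bigID [in S]) /= [X in _ * X]big1 ?mulr1; last first.
  by move=> i /negPf ->.
rewrite (eq_bigr (fun=> x)) ?prodr_const // => i iS.
by rewrite iS sub.
Qed.

(** Deleting [v] is a bijection from the stable sets containing [v] onto those avoiding [v] and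
    N(v), and it divides the weight by [lam]. *)
Lemma hard_core_mem (R : comNzRingType) (T : finType) (e : rel T)
    (A : {set T}) (v : T) (lam : R) :
  simple_graph e -> v \in A ->
  (1 + lam) * (\sum_(S | stable_in e A S && (v \in S)) lam ^+ #|S|) =
  lam * (\sum_(S | stable_in e A S && [disjoint nbhd e v & S]) lam ^+ #|S|).
Proof.
move=> [symE irrE] vA.
have disj S : stable_in e A S -> v \in S -> [disjoint nbhd e v & S].
  move=> /andP[/stable_setP st _] vS; apply/pred0P => u /=.
  rewrite inE; apply/negbTE/negP => /andP[evu uS].
  by have := st v u vS uS; rewrite evu.
have memE : \sum_(S | stable_in e A S && (v \in S)) lam ^+ #|S| = lam *
   \sum_(S | (stable_in e A S && [disjoint nbhd e v & S]) && (v \notin S))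
     lam ^+ #|S|.
  rewrite (reindex_onto (fun S => v |: S) (fun S => S :\ v)) /=; last first.
    by move=> S /andP[_ vS]; rewrite setD1K.
  rewrite mulr_sumr; apply: eq_big => [S|S].
    rewrite setU11 andbT; apply/andP/andP.
      move=> [ok /eqP SE].
      have vS : v \notin S by rewrite -SE !inE eqxx.
      have dj := disj _ ok (setU11 _ _).
      split=> //; rewrite (disjointWr (subsetUr [set v] S)) ?andbT //.
      case/andP: ok => st sub; rewrite /stable_in (stable_setS _ st) ?subsetUr //.
      by rewrite (subset_trans _ sub) ?subsetUr.
    move=> [/andP[/andP[/stable_setP st sub] dj] vS]; split; last by rewrite setU1K.
    rewrite /stable_in subUset sub1set vA sub !andbT; apply/stable_setP => x y.
    have nv y' : y' \in S -> ~~ e v y'.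
      move=> yS; apply/negP => evy; move/pred0P/(_ y'): dj => /=.
      by rewrite inE evy yS.
    move=> /setU1P[->|xS] /setU1P[->|yS]; [by rewrite irrE|exact: nv| |exact: st].
    by rewrite symE; exact: nv.
  case/andP=> _ /eqP SE; rewrite cardsU1 -SE !inE eqxx /= add1n exprS.
  by rewrite SE.
rewrite [X in _ = lam * X](bigID (fun S : {set T} => v \in S)) /= mulrDr -memE.
rewrite mulrDl mul1r addrC; congr (_ * _ + _); apply: eq_bigl => S.
apply/andP/andP => [[ok vS]|[/andP[ok _] vS]] //.
by rewrite ok disj.
Qed.

(* Sum over J = S minus N(v): as N(v) is stable, the sets S with a given J are
   the J :|: S' with S' an arbitrary subset of [free_nbrs e A v J]. *)
Lemma hard_core_disjoint (R : fieldType) (T : finType) (e : rel T)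
    (A : {set T}) (v : T) (lam : R) :
  simple_graph e -> triangle_free e -> 1 + lam != 0 ->
  \sum_(S | stable_in e A S && [disjoint nbhd e v & S]) lam ^+ #|S| =
  \sum_(S | stable_in e A S)
    lam ^+ #|S| * (1 + lam) ^- #|free_nbrs e A v S|.
Proof.
move=> [symE irrE] tf lam1.
rewrite [RHS](partition_big (fun S => S :\: nbhd e v)
  (fun S => stable_in e A S && [disjoint nbhd e v & S])) /=; last first.
  move=> S /andP[st sub].
  rewrite /stable_in (stable_setS (subsetDl _ _) st) /=.
  rewrite (subset_trans (subsetDl _ _) sub) /=.
  by apply/pred0P => u /=; rewrite !inE; case: (e v u).
apply: eq_bigr => J /andP[/andP[stJ subJ] dJ].
have vJ u : u \in J -> ~~ e v u.
  by move=> uJ; apply/negP => evu; move/pred0P/(_ u): dJ => /=; rewrite inE evu uJ.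
set X := free_nbrs e A v J.
rewrite (reindex_onto (fun S => J :|: S) (fun S => S :&: nbhd e v)) /=; last first.
  by move=> S /andP[_ /eqP <-]; rewrite setUC setID.
rewrite (eq_bigl (fun S : {set T} => S \subset X)); last first.
  move=> S; apply/andP/idP.
    move=> [/andP[/andP[/stable_setP st sub] /eqP DE] /eqP SE].
    have SN u : u \in S -> e v u by rewrite -SE !inE => /andP[].
    apply/subsetP => u uS.
    rewrite inE (subsetP sub) ?inE ?uS ?orbT //= SN //=.
    apply/pred0P => w /=; rewrite inE; apply/negbTE/negP => /andP[euw wJ].
    by have := st u w; rewrite !inE uS wJ orbT => /(_ isT isT); rewrite euw.
  move=> /subsetP sub.
  have SN u : u \in S -> e v u by move/sub; rewrite inE => /and3P[].
  have SJ u w : u \in S -> w \in J -> ~~ e u w.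
    move/sub; rewrite inE => /and3P[_ _ /pred0P/(_ w) /=]; rewrite inE.
    by move=> + wJ; rewrite wJ andbT => ->.
  split.
    apply/andP; split; last first.
      apply/eqP/setP => u; rewrite !inE.
      case: (boolP (u \in S)) => [uS|_].
        by rewrite SN //; apply/esym/negbTE/negP => /vJ; rewrite SN.
      by case: (boolP (u \in J)) => [/vJ ->|_]; rewrite ?andbF.
    apply/andP; split; last first.
      rewrite subUset subJ; apply/subsetP => u /sub.
      by rewrite inE => /andP[].
    apply/stable_setP => x y /setUP[xJ|xS] /setUP[yJ|yS].
    - exact: (stable_setP stJ).
    - by rewrite symE; exact: SJ.
    - exact: SJ.
    - apply/negP => exy; have := tf v x y.
      by rewrite exy !SN.
  apply/eqP/setP => u; rewrite !inE.
  case: (boolP (u \in S)) => [/SN ->|_]; first by rewrite orbT.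
  by case: (boolP (u \in J)) => //= /vJ /negPf ->.
rewrite (eq_bigr (fun S : {set T} =>
  lam ^+ #|J| * (1 + lam) ^- #|X| * lam ^+ #|S|)); last first.
  move=> S /subsetP sub.
  have SN u : u \in S -> e v u by move/sub; rewrite inE => /and3P[].
  have -> : free_nbrs e A v (J :|: S) = X.
    apply/setP => u; rewrite !inE; case: (u \in A) => //=.
    case evu: (e v u) => //=; rewrite -!setI_eq0 setIUr setU_eq0.
    rewrite [X in _ && X](_ : _ = true) ?andbT //.
    apply/eqP/setP => w; rewrite !inE; apply/negbTE/negP => /andP[euw wS].
    by have := tf v u w; rewrite evu euw SN.
  rewrite cardsU (_ : J :&: S = set0) ?cards0 ?subn0 ?exprD; first by ring.
  apply/setP => u; rewrite !inE; apply/negbTE/negP => /andP[/vJ + /SN].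
  by move/negPf => ->.
rewrite -mulr_sumr sum_subset_expr -mulrA mulVf ?mulr1 //.
by rewrite expf_neq0.
Qed.

(** * Occupancy bounds for the hard-core distribution *)

Definition marginal {R : realType} {T : finType} (p : {set T} -> R) (v : T) : R :=
  \sum_(S : {set T} | v \in S) p S.

(** Bound [(1 + lam) ^- n] below by [expR (- (lam * n))], then use [1 + y <= expR y] at
    [y = (1 + lam) * E0 - lam * n]; the coefficients are chosen so that the terms in [n] cancel. *)
Lemma hard_core_occupancy (R : realType) (lam E0 : R) (n : nat) :
  0 < lam -> 0 < E0 ->
  1 + lam <= lam * (expR ((1 + lam) * E0) / (lam * E0) * (1 + lam) ^- n
                    + E0^-1 * n%:R).
Proof.
move=> lam0 E00.
have lam1 : 0 < 1 + lam by lra.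
have le1 : expR (- (lam * n%:R)) <= (1 + lam) ^- n.
  rewrite expRN lef_pV2 ?posrE ?expR_gt0 ?exprn_gt0 //.
  rewrite expRM_natr.
  by rewrite lerXn2r ?nnegrE ?expR_ge0 ?expR_ge1Dx ?ltW.
have le2 : 1 + (1 + lam) * E0 <=
    expR ((1 + lam) * E0) * (1 + lam) ^- n + lam * n%:R.
  apply: (@le_trans _ _ (expR ((1 + lam) * E0 - lam * n%:R) + lam * n%:R)).
    by have := expR_ge1Dx ((1 + lam) * E0 - lam * n%:R); lra.
  by rewrite lerD2r expRD ler_pM2l ?expR_gt0.
have -> : lam * (expR ((1 + lam) * E0) / (lam * E0) * (1 + lam) ^- n
                    + E0^-1 * n%:R) =
   (expR ((1 + lam) * E0) * (1 + lam) ^- n + lam * n%:R) / E0.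
  by field; rewrite !gt_eqF ?exprn_gt0.
by rewrite ler_pdivlMr //; lra.
Qed.

Lemma hard_core_distribution (R : realType) (T : finType) (e : rel T)
    (A : {set T}) (lam E0 : R) :
  simple_graph e -> triangle_free e -> 0 < lam -> 0 < E0 ->
  exists2 p : {set T} -> R, stable_distribution e p &
    (forall v, v \notin A -> marginal p v = 0) /\
    (forall v, v \in A -> 1 <=
      expR ((1 + lam) * E0) / (lam * E0) * marginal p v
      + E0^-1 * \sum_(u | e v u) marginal p u).
Proof.
move=> sg tf lam0 E00.
have lam1 : 0 < 1 + lam by lra.
pose Z : R := \sum_(S | stable_in e A S) lam ^+ #|S|.
have w0 (S : {set T}) : 0 < lam ^+ #|S| by exact: exprn_gt0.
have Z0 : 0 < Z.
  rewrite /Z (bigD1 set0) /=; last first.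
    rewrite /stable_in sub0set andbT; apply/stable_setP => x y.
    by rewrite inE.
  by rewrite ltr_wpDr ?cards0 ?expr0 ?ltr01 ?sumr_ge0 // => S _; exact: ltW.
pose p S := if stable_in e A S then lam ^+ #|S| / Z else 0.
have margE v : marginal p v =
    (\sum_(S | stable_in e A S && (v \in S)) lam ^+ #|S|) / Z.
  rewrite /marginal /p -big_mkcondr /= mulr_suml.
  by apply: eq_bigl => S; rewrite andbC.
exists p.
  split=> [S|S nS|].
  - by rewrite /p; case: ifP => // _; rewrite ltW // divr_gt0.
  - by rewrite /p /stable_in (negPf nS).
  - by rewrite /p -big_mkcond /= -mulr_suml divff // gt_eqF.
have marg0 v : v \notin A -> marginal p v = 0.
  move=> vA; rewrite margE big1 ?mul0r // => S /andP[/andP[_ /subsetP sub] /sub].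
  by rewrite (negPf vA).
split=> // v vA; set al := _ / _.
have scaled u : u \in A -> (1 + lam) * Z * marginal p u =
    lam * (\sum_(S | stable_in e A S && [disjoint nbhd e u & S]) lam ^+ #|S|).
  move=> uA; rewrite -hard_core_mem // margE; field.
  by rewrite gt_eqF.
have E1 : (1 + lam) * Z * marginal p v = lam * \sum_(S | stable_in e A S)
    lam ^+ #|S| * (1 + lam) ^- #|free_nbrs e A v S|.
  by rewrite scaled // hard_core_disjoint // gt_eqF.
have E2 : (1 + lam) * Z * (\sum_(u | e v u) marginal p u) =
    lam * \sum_(S | stable_in e A S) lam ^+ #|S| * #|free_nbrs e A v S|%:R.
  rewrite (bigID [in A]) /= [X in _ * (_ + X)]big1 ?addr0; last first.
    by move=> u /andP[_ /marg0].
  rewrite mulr_sumr (eq_bigr _ (fun u h => scaled u (proj2 (andP h)))).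
  rewrite -mulr_sumr; congr (_ * _).
  (* After the exchange, each [S] is counted once per free neighbour of [v]. *)
  rewrite (exchange_big_dep (stable_in e A)) /=; last by move=> u S _ /andP[].
  apply: eq_bigr => S okS; rewrite sumr_const mulr_natr.
  congr (_ *+ _); apply: eq_card => u; rewrite !inE.
  by rewrite [LHS]/in_mem /= okS /= -andbA andbCA.
(* Scaled by [(1 + lam) * Z], both sides are sums over stable [S], compared term by term. *)
rewrite -(ler_pM2l (mulr_gt0 lam1 Z0)) mulr1 mulrDr.
rewrite [X in _ <= X + _]mulrCA [X in _ <= _ + X]mulrCA E1 E2.
rewrite {1}/Z !mulr_sumr -big_split /=; apply: ler_sum => S _.
rewrite [leLHS]mulrC.
have := hard_core_occupancy _ lam E0 #|free_nbrs e A v S| lam0 E00.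
move=> /(ler_wpM2l (ltW (w0 S))) /le_trans; apply; rewrite -/al.
by rewrite le_eqVlt; apply/orP; left; apply/eqP; ring.
Qed.

(** * Fractional covers *)

(** Fractional colouring with vertex demands [r]: varying demands allow recursion on what is left to
    cover. *)
Definition frac_cover {R : realType} {T : finType} (e : rel T) (r : T -> R)
    (c : R) : Prop :=
  exists2 x : {set T} -> R,
    [/\ forall S, 0 <= x S, forall S, ~~ stable_set e S -> x S = 0
      & \sum_S x S <= c] &
    forall v, r v <= marginal x v.

(* Use the distribution attached to the support of the residual demand [r] for
   as long as [r] stays nonnegative: this lowers the demand
   [a r(v) + b r(N(v))] of every unsatisfied vertex at rate at least 1. *)
Lemma greedy_frac_cover (R : realType) (T : finType) (e : rel T) (a b : R) :
  0 <= a -> 0 <= b ->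
  (forall A : {set T}, exists2 p : {set T} -> R, stable_distribution e p &
    (forall v, v \notin A -> marginal p v = 0) /\
    (forall v, v \in A ->
      1 <= a * marginal p v + b * \sum_(u | e v u) marginal p u)) ->
  forall (r : T -> R) (M : R), (forall v, 0 <= r v) -> 0 <= M ->
    (forall v, 0 < r v -> a * r v + b * (\sum_(u | e v u) r u) <= M) ->
  frac_cover e r M.
Proof.
move=> a0 b0 distr r.
have [n] := ubnP #|[set v | 0 < r v]|.
elim: n r => // n IHn r; rewrite ltnS => rn M r0 M0 rM.
have [H0|[v vH]] := set_0Vmem [set v | 0 < r v].
  exists (fun=> 0); first by split=> //; rewrite big1.
  move=> v; rewrite /marginal big1 // leNgt; apply/negP => rv.
  by have : v \in [set v | 0 < r v]; [rewrite inE|rewrite H0 inE].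
have [p [p0 pst p1] [pout pin]] := distr [set v | 0 < r v].
have m0 u : 0 <= marginal p u by apply: sumr_ge0.
(* Otherwise the hypothesis on [p] at [v] would read [1 <= 0]. *)
have [w mw] : exists w, 0 < marginal p w.
  apply/existsP; apply: contraT; rewrite negb_exists => /forallP h.
  have mz u : marginal p u = 0.
    by apply/eqP; rewrite eq_le m0 leNgt h.
  have := pin v vH; rewrite mz big1 ?mulr0 ?addr0 //.
  by rewrite ler10.
case: (@Order.TotalTheory.arg_minP _ _ _ w (fun u => 0 < marginal p u)
  (fun u => r u / marginal p u) mw) => i mi imin.
(* The largest multiple of [p] that keeps the residual nonnegative; it exhausts the demand of [i],
   so the support shrinks. *)
set tau := r i / marginal p i in imin.
have tau0 : 0 <= tau by rewrite divr_ge0.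
pose r' u := r u - tau * marginal p u.
have r'0 u : 0 <= r' u.
  rewrite subr_ge0; have := m0 u; rewrite le_eqVlt => /orP[/eqP <-|mu].
    by rewrite mulr0.
  by rewrite -ler_pdivlMr // imin.
have r'r u : 0 < r' u -> 0 < r u.
  by rewrite /r'; have := mulr_ge0 tau0 (m0 u); lra.
have r'E u : a * r' u + b * (\sum_(w | e u w) r' w) =
    a * r u + b * (\sum_(w | e u w) r w)
    - tau * (a * marginal p u + b * \sum_(w | e u w) marginal p w).
  by rewrite /r' sumrB -mulr_sumr; ring.
have lower u : 0 < r u -> a * r' u + b * (\sum_(w | e u w) r' w) <= M - tau.
  move=> ru; rewrite r'E lerB ?rM // ler_peMr // pin //.
  by rewrite inE.
have [|||x [x0 xst xM] xr] := IHn r' _ (M - tau) r'0.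
- apply: leq_trans rn; apply: proper_card; apply/properP; split.
    by apply/subsetP => u; rewrite !inE => /r'r.
  have ri : 0 < r i.
    have [|/pout mi0] := boolP (i \in [set v | 0 < r v]); first by rewrite inE.
    by move: mi; rewrite mi0 ltxx.
  exists i; first by rewrite inE.
  by rewrite inE /r' /tau divfK ?subrr ?ltxx // gt_eqF.
(* [M - tau] is nonnegative because it bounds a nonnegative quantity at [v]. *)
- move: vH; rewrite inE => /lower; apply: le_trans.
  by rewrite addr_ge0 ?mulr_ge0 ?sumr_ge0.
- by move=> u /r'r /lower.
exists (fun S => x S + tau * p S).
  split=> [S|S nS|].
  - by rewrite addr_ge0 // mulr_ge0.
  - by rewrite xst // pst // mulr0 addr0.
  - by rewrite big_split /= -mulr_sumr p1; lra.
move=> u; rewrite /marginal big_split /= -mulr_sumr -/(marginal _ _).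
by have := xr u; rewrite /r' lerBlDr.
Qed.

Lemma frac_cover_max_degree (R : realType) (T : finType) (e : rel T)
    (a b D : R) (A : {set T}) :
  (forall (r : T -> R) (M : R), (forall v, 0 <= r v) -> 0 <= M ->
    (forall v, 0 < r v -> a * r v + b * (\sum_(u | e v u) r u) <= M) ->
    frac_cover e r M) ->
  0 <= a -> 0 <= b -> 0 <= D ->
  (forall v, v \in A -> #|nbhd e v :&: A|%:R <= D) ->
  frac_cover e (fun v => (v \in A)%:R) (a + b * D).
Proof.
move=> greedy a0 b0 D0 deg; apply: greedy => // [|v].
  by rewrite addr_ge0 ?mulr_ge0.
case: (boolP (v \in A)) => [vA _|_]; last by rewrite ltxx.
rewrite mulr1 lerD2l ler_wpM2l // (le_trans _ (deg v vA)) //.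
rewrite -natr_sum ler_nat -sum1_card.
rewrite [leqRHS](eq_bigl (fun u => e v u && (u \in A))) => [|u].
  by rewrite big_mkcondr /=; apply: leq_sum => u _; case: (u \in A).
by rewrite !inE.
Qed.

(* Writing s(m) = sqrt (2 b m), removing the neighbourhood of a vertex of degree
   more than s(m) / b costs one colour and decreases s by at least 1; if there
   is no such vertex, the maximum degree bound costs at most a + s(m). *)
Lemma frac_cover_order (R : realType) (T : finType) (e : rel T) (a b : R) :
  triangle_free e -> 0 <= a -> 0 < b ->
  (forall (r : T -> R) (M : R), (forall v, 0 <= r v) -> 0 <= M ->
    (forall v, 0 < r v -> a * r v + b * (\sum_(u | e v u) r u) <= M) ->
    frac_cover e r M) ->
  forall A : {set T},
    frac_cover e (fun v => (v \in A)%:R) (a + Num.sqrt (2 * b * #|A|%:R)).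
Proof.
move=> tf a0 b0 greedy A.
have [n] := ubnP #|A|; elim: n A => // n IHn A; rewrite ltnS => An.
set m : R := #|A|%:R; set s := Num.sqrt (2 * b * m).
have m0 : 0 <= m by [].
have s0 : 0 <= s by exact: sqrtr_ge0.
have s2 : s ^+ 2 = 2 * b * m by rewrite sqr_sqrtr // !mulr_ge0 // ltW.
have [/existsP[v /andP[vA deg]]|/existsPn deg] := boolP
    [exists v, (v \in A) && (s / b < #|nbhd e v :&: A|%:R)]; last first.
  have -> : s = b * (s / b) by rewrite mulrC divfK // gt_eqF.
  apply: frac_cover_max_degree => // [||v vA].
  - exact: ltW.
  - by rewrite divr_ge0 // ltW.
  - by have := deg v; rewrite vA /= -leNgt.
set N := nbhd e v :&: A in deg.
have cardA : (#|A| = #|N| + #|A :\: nbhd e v|)%N.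
  by rewrite /N setIC cardsID.
have N0 : (0 < #|N|)%N.
  by rewrite -(ltr0n R) (le_lt_trans _ deg) // divr_ge0 // ltW.
have [|x [x0 xst xM] xr] := IHn (A :\: nbhd e v).
  by apply: leq_trans An; rewrite cardA -[X in (X < _)%N]add0n ltn_add2r.
have mE : m = #|N|%:R + #|A :\: nbhd e v|%:R by rewrite /m cardA natrD.
set k : R := #|A :\: nbhd e v|%:R in xM mE.
have k0 : 0 <= k by [].
set d : R := #|N|%:R in deg mE.
have sd : s < b * d by move: deg; rewrite ltr_pdivrMr // mulrC.
have bk0 : 0 <= b * k by rewrite mulr_ge0 // ltW.
have s2' : s ^+ 2 = 2 * (b * d) + 2 * (b * k) by rewrite s2 mE; ring.
have s2_ge : 2 * s <= s ^+ 2 by lra.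
have s_gt0 : 0 < s.
  rewrite lt_neqAle s0 andbT; apply/eqP => sz.
  by move: s2' sd; rewrite -sz expr0n /=; lra.
have s1 : 1 <= s by move: s2_ge; rewrite expr2 ler_pM2r //; lra.
(* Indeed [2 * b * k = s ^+ 2 - 2 * b * d < s ^+ 2 - 2 * s < (s - 1) ^+ 2]. *)
have sk : Num.sqrt (2 * b * k) <= s - 1.
  rewrite -[leRHS]ger0_norm ?subr_ge0 // -sqrtr_sqr ler_wsqrtr //.
  have -> : (s - 1) ^+ 2 = s ^+ 2 - 2 * s + 1 by ring.
  by lra.
(* [N] is stable, lying in a neighbourhood of a triangle-free graph, and serves as one full colour
   class. *)
exists (fun S => x S + (S == N)%:R).
  split=> [S|S nS|].
  - by rewrite addr_ge0.
  - rewrite xst // add0r; case: eqP => // SN; move/negP: nS; case.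
    rewrite SN; apply/stable_setP => y z; rewrite !inE.
    move=> /andP[evy _] /andP[evz _]; apply/negP => eyz.
    by have := tf v y z; rewrite evy eyz evz.
  - rewrite big_split /= [X in _ + X <= _](bigD1 N) //= eqxx [X in _ + (_ + X)]big1 ?addr0.
      by rewrite -[true%:R]/(1 : R); lra.
    by move=> S /negPf ->.
move=> u; have := xr u; rewrite /marginal big_split /= => xu.
rewrite (le_trans _ (lerD xu (lexx _))) // inE.
have [uA|_] := boolP (u \in A); last by rewrite andbF addr_ge0 ?sumr_ge0.
case: (boolP (u \in nbhd e v)) => /= uN; last by rewrite lerDl sumr_ge0.
rewrite (bigD1 N) /= ?inE ?uA ?andbT; last by rewrite inE in uN.
by rewrite eqxx add0r lerDl sumr_ge0.
Qed.

(** * From covers to the fractional chromatic number *)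

(** Dividing a cover by its total weight, which is at least 1 since some vertex is covered, gives a
    distribution. *)
Lemma fractional_chromatic_number_le (R : realType) (T : finType) (e : rel T)
    (c : R) :
  irreflexive e -> (0 < #|T|)%N -> frac_cover e (fun=> 1) c ->
  fractional_chromatic_number R e <= c.
Proof.
move=> irrE T0 [x [x0 xst xc] xr].
have /card_gt0P[v _] := T0.
set X := \sum_S x S in xc.
have margX u : marginal x u <= X.
  rewrite /marginal /X [leRHS](bigID [pred S : {set T} | u \in S]) /=.
  by rewrite lerDl sumr_ge0.
have X1 : 1 <= X by exact: le_trans (xr v) (margX v).
have X0 : 0 < X by exact: lt_le_trans X1.
have [_] := @fractional_chromatic_number_min R T e irrE T0; apply.
split; first exact: lt_le_trans xc.
exists (fun S => x S / X).
  split=> [S|S nS|].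
  - by rewrite divr_ge0 // ltW.
  - by rewrite xst // mul0r.
  - by rewrite -mulr_suml divff // gt_eqF.
move=> u; rewrite -mulr_suml -/(marginal x u).
apply: (@le_trans _ _ X^-1).
  by rewrite lef_pV2 // posrE // (lt_le_trans X0).
by rewrite ler_peMl ?invr_ge0 // ltW.
Qed.

(** * Choice of parameters and conclusion *)

Lemma hard_core_parameters (R : realType) (eps : R) : 0 < eps ->
  exists lam : R, exists c : R, exists K : R, [/\ 0 < lam, 0 < c &
    forall L, K <= L -> 0 < L /\
      expR ((1 + lam) * (c * L)) / (lam * (c * L))
      + Num.sqrt (2 * (c * L)^-1 * expR L) <=
      (2 + eps) * Num.sqrt (expR L / L)].
Proof.
move=> eps0; pose t := 1 + eps / 4.
have t1 : 1 < t by rewrite /t; lra.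
have t0 : 0 < t by lra.
have t2 : 1 < t ^+ 2 by rewrite expr_gt1 // ltW.
(* Here [L] is [ln n] and [E0 = c * L]. Then [2 / c = (2 * t) ^+ 2] with [2 * t = 2 + eps / 2],
   leaving [eps / 2] for the first term, whose exponent is [(1 - lam ^+ 2) / 2 * L]. *)
pose lam := 1 - (t ^+ 2)^-1.
have lam0 : 0 < lam by rewrite subr_gt0 invf_lt1 ?(lt_trans ltr01).
pose c := (1 - lam) / 2.
have cE : c = (t ^+ 2)^-1 / 2 by rewrite /c /lam; field; rewrite gt_eqF.
have c0 : 0 < c by rewrite cE divr_gt0 ?invr_gt0 ?exprn_gt0.
(* This threshold gives [1 <= L] and makes [expR (lam ^+ 2 / 2 * L)] exceed
   [(lam * c * (eps / 2))^-1]. *)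
exists lam, c, (1 + (lam * c * (eps / 2))^-1 / (lam ^+ 2 / 2)); split=> // L LK.
have e2 : 0 < eps / 2 by lra.
have lce0 := mulr_gt0 (mulr_gt0 lam0 c0) e2.
have l2 : 0 < lam ^+ 2 / 2 by rewrite divr_gt0 ?exprn_gt0.
have K0 : 0 < (lam * c * (eps / 2))^-1 / (lam ^+ 2 / 2).
  by rewrite divr_gt0 // invr_gt0.
have L1 : 1 <= L by lra.
have L0 : 0 < L by lra.
split=> //.
set q := Num.sqrt (expR L / L).
have q0 : 0 <= q by exact: sqrtr_ge0.
have -> : Num.sqrt (2 * (c * L)^-1 * expR L) = 2 * t * q.
  rewrite -[2 * t]ger0_norm; last by rewrite mulr_ge0 // ltW.
  rewrite -sqrtr_sqr -sqrtrM ?sqr_ge0 //; congr Num.sqrt.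
  by rewrite cE; field; rewrite !gt_eqF.
have qL : expR (L / 2) / L <= q.
  rewrite -[leLHS]ger0_norm; last by rewrite divr_ge0 ?expR_ge0 // ltW.
  rewrite -sqrtr_sqr ler_wsqrtr // expr_div_n -expRM_natr.
  rewrite divfK ?pnatr_eq0 // ler_pM2l ?expR_gt0 // lef_pV2 ?posrE ?exprn_gt0 //.
  by rewrite expr2 ler_peMr // ltW.
have aq : expR ((1 + lam) * (c * L)) / (lam * (c * L)) <= eps / 2 * q.
  have -> : (1 + lam) * (c * L) = L / 2 - lam ^+ 2 / 2 * L by rewrite /c; field.
  rewrite expRB.
  have -> : expR (L / 2) / expR (lam ^+ 2 / 2 * L) / (lam * (c * L)) =
     ((lam * c)^-1 / expR (lam ^+ 2 / 2 * L)) * (expR (L / 2) / L).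
    by field; rewrite !gt_eqF ?expR_gt0.
  apply: ler_pM => //.
  - by rewrite divr_ge0 ?invr_ge0 ?expR_ge0 // mulr_ge0 // ltW.
  - by rewrite divr_ge0 ?expR_ge0 // ltW.
  have : (lam * c * (eps / 2))^-1 <= lam ^+ 2 / 2 * L.
    by rewrite [leRHS]mulrC -ler_pdivrMr //; lra.
  have := expR_ge1Dx (lam ^+ 2 / 2 * L).
  rewrite ler_pdivrMr ?expR_gt0 // -ler_pdivrMl // -invfM [eps / 2 * _]mulrC.
  by lra.
rewrite (le_trans (lerD aq (lexx _))) //.
by rewrite le_eqVlt; apply/orP; left; apply/eqP; rewrite /t; field.
Qed.

Theorem theorem1p4 (R : realType) (eps : R) (eps_gt0 : 0 < eps) :
  exists n0 : nat, forall (T : finType) (e : rel T),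
    simple_graph e -> triangle_free e -> (n0 <= #|T|)%N ->
    fractional_chromatic_number R e <=
      (2 + eps) * Num.sqrt (#|T|%:R / ln #|T|%:R).
Proof.
have [lam [c [K [lam0 c0 large]]]] := hard_core_parameters _ _ eps_gt0.
exists (Num.bound (expR K)) => T e sg tf nT.
have KT : expR K <= #|T|%:R.
  apply: ltW; apply: lt_le_trans (archi_boundP (expR_ge0 K)) _.
  by rewrite ler_nat.
have T0 : 0 < #|T|%:R :> R by apply: lt_le_trans KT; exact: expR_gt0.
set L := ln #|T|%:R.
have LE : expR L = #|T|%:R by rewrite lnK.
have [|L0] := large L; first by rewrite -ler_expR LE.
rewrite LE; apply: le_trans; set a := expR (_ * _) / _; set b := (c * L)^-1.
have cL0 : 0 < c * L by exact: mulr_gt0.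
have a0 : 0 <= a by rewrite divr_ge0 ?expR_ge0 // mulr_ge0 // ltW.
have b0 : 0 < b by rewrite invr_gt0.
have greedy := greedy_frac_cover R T e a b a0 (ltW b0)
  (fun A => hard_core_distribution R T e A lam (c * L) sg tf lam0 cL0).
apply: fractional_chromatic_number_le; first exact: (proj2 sg).
  by rewrite -(ltr0n R).
have [x xP xr] := frac_cover_order R T e a b tf a0 b0 greedy [set: T].
rewrite cardsT in xP; exists x => // v.
by have := xr v; rewrite inE.
Qed.
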